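(* Let $T\colon c\to c$ be the Cesàro operator, and let $x=(x_k)_{k\ge0}\in c$. The following are equivalent: (i) $x_0=\lim_{k\to\infty}x_k$; (ii) the sequence $(T^nx)_{n\ge0}$ converges weakly in $c$ as $n\to\infty$; (iii) the sequence $(T^nx)_{n\ge0}$ converges in norm in $c$ as $n\to\infty$. Furthermore, if these conditions hold then $\|T^nx-Px\|_\infty\to0$ as $n\to\infty$.
   Context: $c$ denotes the complex Banach space of convergent complex sequences $x=(x_k)_{k\ge0}$, endowed with the supremum norm $\|\cdot\|_\infty$. The Cesàro operator $T\colon c\to c$ is the bounded linear operator given by $(Tx)_k=\frac{1}{k+1}\sum_{j=0}^k x_j$ for $k\ge0$. The operator $P\colon c\to c$ is defined by $Px=x_0e_\infty$, where $e_\infty=(1,1,1,\dots)$. *)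

(* Defs.v *)
From HB Require Import structures.
From mathcomp Require Import all_boot all_order all_algebra.
From mathcomp Require Import complex.
From mathcomp Require Import all_classical all_reals topology normedtype sequences.

Set Implicit Arguments.
Unset Strict Implicit.
Unset Printing Implicit Defensive.
Import Order.TTheory GRing.Theory Num.Theory.
Import numFieldNormedType.Exports.
Local Open Scope classical_set_scope.
Local Open Scope ring_scope.

(* [R[i]] carries no topology by itself; packaging it as a numClosedFieldType
   gives it the one the library puts on every such type, namely that of the
   modulus.  Its norm takes its values in [Cplx R] itself. *)
Definition Cplx (R : realType) : numClosedFieldType := R[i].

Definition modulus (R : realType) (z : Cplx R) : R := ComplexField.Normc.normc z.
Definition ofReal (R : realType) (r : R) : Cplx R := real_complex R r.

Section ComplexFacts.
Context {R : realType}.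
Implicit Types (z w : Cplx R) (r : R).

Lemma norm_modulus z : `|z| = ofReal (modulus z).
Proof. by []. Qed.

Lemma ofReal_le r s : (ofReal r <= ofReal s) = (r <= s).
Proof. exact: lecR. Qed.

Lemma ofReal_lt r s : (ofReal r < ofReal s) = (r < s).
Proof. exact: ltcR. Qed.

Lemma ofReal_posE z : 0 < z -> exists2 r : R, 0 < r & z = ofReal r.
Proof.
case: z => a b; rewrite ltcE /= => /andP[/eqP b0 a0].
by exists a => //; rewrite /ofReal b0.
Qed.

Lemma modulus_ge0 z : 0 <= modulus z.
Proof. by rewrite -ofReal_le -norm_modulus; exact: (normr_ge0 z). Qed.

Lemma cvgn_modulusP (x : nat -> Cplx R) z :
  x @ \oo --> z <-> modulus (z - x n) @[n --> \oo] --> (0 : R).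
Proof.
split=> [/cvgrPdist_lt xz|/cvgrPdist_lt xz].
- apply/cvgrPdist_lt => e e0.
  have /xz : 0 < ofReal e by rewrite (ofReal_lt 0).
  apply: filterS => n; rewrite norm_modulus ofReal_lt sub0r normrN.
  by rewrite ger0_norm // modulus_ge0.
- apply/cvgrPdist_lt => e /ofReal_posE[r r0 ->].
  move: (xz _ r0); apply: filterS => n.
  by rewrite norm_modulus ofReal_lt sub0r normrN ger0_norm // modulus_ge0.
Qed.

End ComplexFacts.

Definition cvg_seqs (R : realType) : {pred (nat -> Cplx R)} :=
  [pred x | `[< cvgn x >]].

Record cspace (R : realType) := CSpace {
  cseq :> nat -> Cplx R ;
  _ : cseq \in @cvg_seqs R }.

HB.instance Definition _ (R : realType) := [isSub for @cseq R].
HB.instance Definition _ (R : realType) := [Choice of cspace R by <:].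

Lemma is_cvgn_linear (K : numFieldType) (a : K) (x y : nat -> K) :
  cvgn x -> cvgn y -> cvgn (fun n => a * x n + y n).
Proof.
by move=> cx cy; apply: is_cvgD => //; apply: is_cvgM => //; exact: is_cvg_cst.
Qed.

Section CSpaceLmodule.
Context {R : realType}.

Lemma cvg_seqsP (x : nat -> Cplx R) : reflect (cvgn x) (x \in @cvg_seqs R).
Proof. exact: asboolP. Qed.

Lemma cspace_cvg (x : cspace R) : cvgn x.
Proof. by apply/cvg_seqsP; exact: (valP x). Qed.

Lemma cvg_seqs_submod : submod_closed (@cvg_seqs R).
Proof.
split; first by apply/cvg_seqsP; exact: is_cvg_cst.
move=> a x y /cvg_seqsP cx /cvg_seqsP cy; apply/cvg_seqsP.
exact: (is_cvgn_linear cx cy).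
Qed.

HB.instance Definition _ :=
  GRing.isSubmodClosed.Build _ _ (@cvg_seqs R) cvg_seqs_submod.
HB.instance Definition _ := [SubChoice_isSubLmodule of cspace R by <:].

End CSpaceLmodule.

Section CSpaceNorm.
Context {R : realType}.
Implicit Types x y : cspace R.

Definition supnorm x : R := sup (range (fun k => modulus (x k))).

Lemma cspace_bounded x : has_ubound (range (fun k => modulus (x k))).
Proof.
have /cvg_seq_bounded [M [Mreal Mx]] := @cspace_cvg R x.
have M1 : M < `|M| + 1.
  by rewrite (le_lt_trans (real_ler_norm Mreal))// ltrDl.
have := Mx _ M1 => {}Mx.
exists (modulus (`|M| + 1)) => _ [k _ <-].
rewrite -ofReal_le -!norm_modulus (ger0_norm (x := `|M| + 1)) ?addr_ge0//.
exact: Mx.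
Qed.

Lemma modulus_le_supnorm x k : modulus (x k) <= supnorm x.
Proof. by apply: ub_le_sup; [exact: cspace_bounded|exists k]. Qed.

Lemma supnorm_le x (M : R) : (forall k, modulus (x k) <= M) -> supnorm x <= M.
Proof.
move=> xM; apply: ge_sup; first by exists (modulus (x 0%N)); exists 0%N.
by move=> _ [k _ <-].
Qed.

Lemma modulusD (z w : Cplx R) : modulus (z + w) <= modulus z + modulus w.
Proof. by rewrite -ofReal_le {2}/ofReal rmorphD; exact: (ler_normD z w). Qed.

Lemma modulusM (z w : Cplx R) : modulus (z * w) = modulus z * modulus w.
Proof. exact: ComplexField.Normc.normcM. Qed.

Let norm x : Cplx R := ofReal (supnorm x).

Let norm_triangle x y : norm (x + y) <= norm x + norm y.
Proof.
suff : supnorm (x + y) <= supnorm x + supnorm y.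
  by rewrite -ofReal_le /ofReal rmorphD.
apply: supnorm_le => k; apply: (le_trans (modulusD _ _)).
by rewrite lerD // modulus_le_supnorm.
Qed.

Let normZ (a : Cplx R) x : norm (a *: x) = `|a| * norm x.
Proof.
suff : supnorm (a *: x) = modulus a * supnorm x.
  by rewrite /norm norm_modulus => ->; rewrite /ofReal rmorphM.
have leZ b z : supnorm (b *: z) <= modulus b * supnorm z.
  apply: supnorm_le => k; rewrite [modulus _](modulusM b (z k)).
  by rewrite ler_wpM2l ?modulus_ge0// modulus_le_supnorm.
apply/eqP; rewrite eq_le leZ /=.
have [->|a0] := eqVneq a 0.
  rewrite [modulus 0]ComplexField.Normc.normc0 mul0r.
  exact: le_trans (modulus_ge0 _) (modulus_le_supnorm _ 0%N).
have ma0 : 0 < modulus a.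
  by rewrite -ofReal_lt -norm_modulus (normr_gt0 a).
rewrite mulrC -ler_pdivlMr // mulrC.
have := leZ a^-1 (a *: x).
by rewrite scalerA mulVf // scale1r [modulus a^-1]ComplexField.Normc.normcV.
Qed.

Let norm_eq0 x : norm x = 0 -> x = 0.
Proof.
move=> /(congr1 (@complex.Re R)) /= x0; apply: val_inj; apply: funext => k.
apply: ComplexField.Normc.eq0_normc; apply/eqP.
by rewrite eq_le modulus_ge0 andbT -[leRHS]x0 modulus_le_supnorm.
Qed.

HB.instance Definition _ := Lmodule_isNormed.Build (Cplx R) (cspace R)
  norm_triangle normZ norm_eq0.

Lemma cspace_normE x : `|x| = ofReal (supnorm x).
Proof. by []. Qed.

End CSpaceNorm.

Section Operators.
Context {R : realType}.
Implicit Types x y : cspace R.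

Definition cesaro_seq (x : nat -> Cplx R) (k : nat) : Cplx R :=
  k.+1%:R^-1 * \sum_(j < k.+1) x j.

Lemma modulus_cesaro_le (x : nat -> Cplx R) (k : nat) :
  modulus (cesaro_seq x k) <= arithmetic_mean (fun j => modulus (x j)) k.
Proof.
rewrite -ofReal_le -norm_modulus /cesaro_seq normrM normfV normr_nat.
rewrite /arithmetic_mean /= /ofReal rmorphM fmorphV rmorph_nat.
rewrite ler_wpM2l ?invr_ge0 ?ler0n // seriesEnat /= rmorph_sum big_mkord /=.
exact: ler_norm_sum.
Qed.

Lemma cesaro_seq_cvg (x : nat -> Cplx R) (z : Cplx R) :
  x @ \oo --> z -> cesaro_seq x @ \oo --> z.
Proof.
move=> xz0; have xz := cesaro (iffLR (cvgn_modulusP x z) xz0); apply/(cvgn_modulusP _ z).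
apply: (squeeze_cvgr _ (cvg_cst _) xz); apply: nearW => k.
rewrite modulus_ge0 /=.
suff -> : z - cesaro_seq x k = cesaro_seq (fun j => z - x j) k.
  exact: modulus_cesaro_le.
rewrite /cesaro_seq sumrB sumr_const card_ord mulrBr -[z *+ _]mulr_natl mulKf //.
by rewrite pnatr_eq0.
Qed.

Lemma cesaro_subproof x : cesaro_seq x \in @cvg_seqs R.
Proof.
apply/cvg_seqsP; apply/cvg_ex; exists (limn x).
by apply: cesaro_seq_cvg; exact: cspace_cvg.
Qed.

Definition cesaro_op x : cspace R := CSpace (cesaro_subproof x).

Lemma cst_subproof (z : Cplx R) : (fun _ : nat => z) \in @cvg_seqs R.
Proof. by apply/cvg_seqsP; exact: is_cvg_cst. Qed.

Definition e_infty : cspace R := CSpace (cst_subproof 1).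

Definition P_op x : cspace R := x 0%N *: e_infty.

Fact cesaro_op_linear : linear cesaro_op.
Proof.
move=> a x y; apply: val_inj; apply: funext => k.
suff : k.+1%:R^-1 * \sum_(j < k.+1) (a * x j + y j) =
    a * (k.+1%:R^-1 * \sum_(j < k.+1) x j) + k.+1%:R^-1 * \sum_(j < k.+1) y j.
  exact.
by rewrite big_split /= -mulr_sumr mulrDr mulrCA.
Qed.

HB.instance Definition _ :=
  GRing.isLinear.Build (Cplx R) (cspace R) (cspace R) _ cesaro_op
    cesaro_op_linear.

Fact P_op_linear : linear P_op.
Proof. by move=> a x y; rewrite /P_op scalerDl -scalerA. Qed.

HB.instance Definition _ :=
  GRing.isLinear.Build (Cplx R) (cspace R) (cspace R) _ P_op P_op_linear.

Lemma cesaro_op_contraction x : `|cesaro_op x| <= `|x|.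
Proof.
rewrite !cspace_normE ofReal_le; apply: supnorm_le => k.
apply: (le_trans (modulus_cesaro_le _ _)).
rewrite /arithmetic_mean /= ler_pdivrMl ?ltr0n // seriesEnat /= big_mkord.
apply: (@le_trans _ _ (\sum_(j < k.+1) supnorm x)).
  by apply: ler_sum => j _; exact: modulus_le_supnorm.
by rewrite sumr_const card_ord mulr_natl.
Qed.

End Operators.

Definition weakly_cvg (K : numFieldType) (V : normedModType K)
    (u : nat -> V) (l : V) : Prop :=
  forall f : {linear V -> K^o}, continuous f -> f (u n) @[n --> \oo] --> f l.

(* Main.v *)
(* Let y = x - Px, so that y_0 = 0 and y tends to 0.  Since T is positive,
   |y| <= e + M w with w = 1_{[1, m]}, hence |T^n y| <= e + M T^n w, and it
   suffices that u_n = T^n w tends to 0 uniformly.  Comparison with the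
   eigenvector (k)_k of eigenvalue 1/2 gives u_n(k) <= k / 2^n.  For large k, use
     u_{n+1}(k+1) = p u_n(k+1) + (1 - p) u_{n+1}(k),   p = 1/(k+2),
   which advances in k while averaging over shifts in n: for k >= m the energy
   sum_n u_n(k)^2 drops by at least p sum_n (u_{n+1}(k+1) - u_n(k+1))^2 when k
   increases by one.  If sup_n u_n(k) stayed above e, this dissipation would be
   bounded below by a Nash inequality, which is impossible as sum p diverges.
   Conversely a weak limit l of T^n x satisfies Tl = l, hence is constant, while
   the coordinate 0 and the limit are bounded functionals invariant under T. *)
From HB Require Import structures.
Require Import Defs.
From mathcomp Require Import all_boot all_order all_algebra ring lra.
From mathcomp Require Import all_classical all_reals topology normedtype sequences.
Set Implicit Arguments.
Unset Strict Implicit.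
Unset Printing Implicit Defensive.
Import Order.TTheory GRing.Theory Num.Theory.
Import numFieldNormedType.Exports.
Local Open Scope classical_set_scope.
Local Open Scope ring_scope.

(** Bounded tails would bound the nondecreasing partial sums, so the harmonic series would
    converge. *)
Lemma harmonic_unbounded (R : realType) (B : R) (m : nat) :
  exists K, B < \sum_(m <= k < K) k.+1%:R^-1.
Proof.
apply: contrapT => H.
apply: (@dvg_harmonic R).
apply: nondecreasing_is_cvgn.
  by apply: nondecreasing_series => k _ _; rewrite invr_ge0 ler0n.
exists (series harmonic m + Num.max 0 B) => _ [n _ <-].
rewrite -lerBlDl sub_series; case: ifP => mn; last first.
  apply: (@le_trans _ _ 0); last by rewrite le_max lexx.
  rewrite oppr_le0.
  by apply: sumr_ge0 => k _; rewrite invr_ge0 ler0n.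
rewrite le_max leNgt; apply/orP; right; rewrite leNgt; apply/negP => Bs.
by apply: H; exists n.
Qed.

(** * Energy method for the averaging recursion *)

Section EnergyDecay.
Variables (R : realType) (u : nat -> nat -> R) (m : nat) (C : R).
Hypothesis u_rec : forall n k, (m <= k)%N ->
  u n.+1 k.+1 = k.+2%:R^-1 * u n k.+1 + (1 - k.+2%:R^-1) * u n.+1 k.
Hypothesis u_init : forall k, (m < k)%N -> u 0 k = 0.
Hypothesis u_m : forall N, \sum_(n < N) u n.+1 m ^+ 2 <= C.

Let energy N k := \sum_(n < N) u n.+1 k ^+ 2.
Let dissipation N k := \sum_(n < N) (u n.+1 k - u n k) ^+ 2.

(** Shifting [n] by one trades the zero term [u 0 k] for one more square. *)
Lemma energy_shift N k : (m < k)%N ->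
  \sum_(n < N) u n k ^+ 2 <= energy N k.
Proof.
move=> mk; case: N => [|N]; first by rewrite /energy !big_ord0.
rewrite big_ord_recl /= u_init // expr0n add0r /energy big_ord_recr /=.
by rewrite lerDl sqr_ge0.
Qed.

Lemma energy_drop N k : (m <= k)%N ->
  k.+2%:R^-1 * dissipation N k.+1 <= energy N k - energy N k.+1.
Proof.
move=> mk; set p := k.+2%:R^-1.
have p0 : 0 <= p by rewrite invr_ge0 ler0n.
have p1 : p < 1 by rewrite invf_lt1 ?ltr0n // ltr1n.
(* With [a = u n.+1 k.+1] and [b = u n k.+1], the recursion reads [(1 - p) u n.+1 k = a - p b], and
   [(a - p b)^2 = (1 - p) a^2 - p (1 - p) b^2 + p (a - b)^2] is summed over [n]. *)
have E : (1 - p) ^+ 2 * energy N k = (1 - p) * energy N k.+1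
    - p * (1 - p) * \sum_(n < N) u n k.+1 ^+ 2 + p * dissipation N k.+1.
  rewrite /energy /dissipation !mulr_sumr -sumrB -big_split /=.
  apply: eq_bigr => n _; have := u_rec n mk; rewrite -/p => ur.
  rewrite -exprMn.
  have -> : (1 - p) * u n.+1 k = u n.+1 k.+1 - p * u n k.+1 by rewrite ur; ring.
  by ring.
have S : p * (1 - p) * \sum_(n < N) u n k.+1 ^+ 2 <= p * (1 - p) * energy N k.+1.
  by apply: ler_wpM2l; [nra|exact: energy_shift].
have D0 : 0 <= dissipation N k.+1 by apply: sumr_ge0 => n _; exact: sqr_ge0.
have q0 : 0 < (1 - p) ^+ 2 by rewrite exprn_gt0 // subr_gt0.
rewrite -(ler_pM2l q0) mulrBr E.
have : (1 - p) ^+ 2 * (p * dissipation N k.+1) <= p * dissipation N k.+1.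
  by rewrite ler_piMl ?mulr_ge0 // expr_le1 //; lra.
by nra.
Qed.

(* One-dimensional Nash inequality: telescope [u n k ^+ 2], then apply AM-GM. *)
Lemma sqr_le_dissipation N k n t : (m < k)%N -> (n <= N)%N -> 0 < t ->
  u n k ^+ 2 <= dissipation N k / (2 * t) + 2 * t * energy N k.
Proof.
move=> mk nN t0.
have -> : u n k ^+ 2 = \sum_(0 <= i < n) (u i.+1 k ^+ 2 - u i k ^+ 2).
  by rewrite (telescope_sumr (fun i => u i k ^+ 2)) // u_init // expr0n subr0.
have step i : u i.+1 k ^+ 2 - u i k ^+ 2 <= (u i.+1 k - u i k) ^+ 2 / (2 * t)
   + t * (u i.+1 k ^+ 2 + u i k ^+ 2).
  set a := u i.+1 k; set b := u i k.
  (* The gap in the AM-GM bound is written as a sum of squares over [2 t]. *)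
  have -> : (a - b) ^+ 2 / (2 * t) + t * (a ^+ 2 + b ^+ 2) =
     a ^+ 2 - b ^+ 2 + ((a - b - t * (a + b)) ^+ 2 + t ^+ 2 * (a - b) ^+ 2) / (2 * t).
    by field; lra.
  rewrite lerDl; apply: divr_ge0; last by lra.
  by rewrite addr_ge0 ?sqr_ge0 // -exprMn sqr_ge0.
apply: (le_trans (ler_sum_nat (fun i _ => step i))).
apply: (@le_trans _ _ (\sum_(0 <= i < N) ((u i.+1 k - u i k) ^+ 2 / (2 * t)
   + t * (u i.+1 k ^+ 2 + u i k ^+ 2)))).
  rewrite (big_cat_nat (n := n) (p := N)) //= lerDl sumr_ge0 // => i _.
  apply: addr_ge0; first by apply: divr_ge0; [exact: sqr_ge0|lra].
  by apply: mulr_ge0; [exact: ltW|rewrite addr_ge0 ?sqr_ge0].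
rewrite big_mkord big_split /= -mulr_suml -mulr_sumr big_split /=.
rewrite lerD2l -/(energy N k); have := energy_shift N mk; nra.
Qed.

(** Each new entry is a convex combination of its predecessor in [n], starting from
    [u 0 k = 0 <= e], and of an entry of the previous column. *)
Lemma max_nonincreasing N k k' (e : R) : 0 <= e -> (m <= k <= k')%N ->
  (forall n, (n <= N)%N -> u n.+1 k <= e) ->
  forall n, (n <= N)%N -> u n.+1 k' <= e.
Proof.
move=> e0 /andP[mk]; elim: k' => [|k' IH]; first by rewrite leqn0 => /eqP <-.
rewrite leq_eqVlt => /predU1P[<- //|kk'] ue.
have {}IH := IH kk' ue.
have uk n : (n <= N.+1)%N -> u n k'.+1 <= e.
  elim: n => [_|n IHn nN]; first by rewrite u_init // ltnS (leq_trans mk).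
  rewrite u_rec ?(leq_trans mk) //; set p := _^-1.
  have p0 : 0 <= p by rewrite invr_ge0 ler0n.
  have p1 : p <= 1 by rewrite invf_le1 ?ltr0n // ler1n.
  have := IHn (ltnW nN); have := IH n nN; nra.
by move=> n nN; exact: uk.
Qed.

(* If the maximum stays above [e], the dissipation stays bounded below and the
   divergence of the harmonic series exhausts the energy. *)
Lemma unif_small (e : R) : 0 < e ->
  exists K, forall n k, (K <= k)%N -> u n.+1 k <= e.
Proof.
move=> e0; have C0 : 0 <= C by have := u_m 0; rewrite big_ord0.
(* Chosen so that [2 t (C + 1) = e^2 / 2]: in the Nash bound the energy term then costs at most half
   of [e^2], and a dissipation below [t e^2] costs at most the other half. *)
pose t := e ^+ 2 / (4 * (C + 1)).
have e20 : 0 < e ^+ 2 by rewrite exprn_gt0.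
have t0 : 0 < t by rewrite divr_gt0 //; lra.
have [K CK] := harmonic_unbounded (C / (t * e ^+ 2)) m.+1.
have mK : (m <= K)%N.
  rewrite leqNgt; apply/negP => Km; move: CK.
  rewrite big_geq ?(leqW (ltnW Km)) // ltNge => /negP; apply.
  by rewrite divr_ge0 // mulr_ge0 // ltW.
exists K => n k Kk.
(* One good column up to [K] suffices, since the maximum cannot grow afterwards. The column may
   depend on [n], but [K] does not. *)
suff : exists2 j, (m <= j <= K)%N & forall i, (i <= n)%N -> u i.+1 j <= e.
  case=> j /andP[mj jK] H.
  apply: (@max_nonincreasing n j k e (ltW e0)) => //.
  by rewrite mj (leq_trans jK).
apply: contrapT => H.
have Ele j : (m <= j)%N -> energy n.+1 j <= C.
  elim: j => [|j IH]; first by rewrite leqn0 => /eqP m0; rewrite -m0; exact: u_m.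
  rewrite leq_eqVlt => /predU1P[<- //|mj]; first exact: u_m.
  apply: le_trans (IH mj); rewrite -subr_ge0.
  apply: le_trans (energy_drop n.+1 mj); rewrite mulr_ge0 ?invr_ge0 ?ler0n //.
  by apply: sumr_ge0 => i _; exact: sqr_ge0.
have D j : (m < j <= K)%N -> t * e ^+ 2 <= dissipation n.+1 j.
  move=> /andP[mj jK]; rewrite leNgt; apply/negP => Dj.
  apply: H; exists j; first by rewrite (ltnW mj).
  move=> i ni.
  have [u0|/ltW u0] := lerP (u i.+1 j) 0; first exact: le_trans (ltW e0).
  rewrite -(@ler_pXn2r _ 2) ?nnegrE ?(ltW e0) //.
  have ni' : (i.+1 <= n.+1)%N by [].
  apply: le_trans (sqr_le_dissipation mj ni' t0) _.
  have D1 : dissipation n.+1 j / (2 * t) <= e ^+ 2 / 2.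
    by rewrite ler_pdivrMr; lra.
  have E1 := Ele j (ltnW mj).
  have tC : 2 * t * (C + 1) = e ^+ 2 / 2 by rewrite /t; field; lra.
  by nra.
(* Accumulated energy drops from column [m] to column [j]; at [j = K] they exceed the available
   energy [C]. *)
have S j : (m <= j <= K)%N ->
    t * e ^+ 2 * \sum_(m.+1 <= k < j.+1) k.+1%:R^-1 <= C - energy n.+1 j.
  elim: j => [|j IH].
    rewrite leqn0 => /andP[/eqP m0 _].
    by rewrite big_geq ?m0 // mulr0 subr_ge0 Ele // m0.
  move=> /andP[]; rewrite leq_eqVlt => /predU1P[<- _|mj jK].
    by rewrite big_geq // mulr0 subr_ge0 Ele.
  rewrite big_nat_recr //=.
  have /IH {}IH : (m <= j <= K)%N by rewrite -ltnS mj ltnW.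
  have Dr := energy_drop n.+1 mj.
  have Dj : t * e ^+ 2 <= dissipation n.+1 j.+1 by apply: D; rewrite mj.
  have {Dj} : t * e ^+ 2 / j.+2%:R <= energy n.+1 j - energy n.+1 j.+1.
    by apply: le_trans Dr; rewrite mulrC ler_wpM2l // invr_ge0 ler0n.
  by rewrite mulrDr => /(lerD IH); rewrite addrA subrK.
have te0 : 0 < t * e ^+ 2 by rewrite mulr_gt0.
have := S K; rewrite mK leqnn => /(_ isT); apply/negP; rewrite -ltNge.
apply: (@le_lt_trans _ _ C).
  by rewrite gerBl; apply: sumr_ge0 => i _; exact: sqr_ge0.
rewrite mulrC -ltr_pdivrMr //; apply: lt_le_trans CK _.
have [mK1|Km] := leqP m.+1 K.
  by rewrite big_nat_recr //= lerDl invr_ge0 ler0n.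
by rewrite big_geq ?(ltnW Km) // sumr_ge0 // => i _; rewrite invr_ge0 ler0n.
Qed.
End EnergyDecay.

(** * Averages over any numeric field, for real majorants and complex sequences alike *)

Definition mean (K : numFieldType) (u : nat -> K) (k : nat) : K :=
  k.+1%:R^-1 * \sum_(j < k.+1) u j.

Lemma meanS (K : numFieldType) (u : nat -> K) k :
  mean u k.+1 = k.+2%:R^-1 * u k.+1 + (1 - k.+2%:R^-1) * mean u k.
Proof.
rewrite /mean big_ord_recr /= mulrDr addrC; congr (_ + _).
have q0 : k.+1%:R != 0 :> K by rewrite pnatr_eq0.
have q1 : k.+1%:R + 1 != 0 :> K by rewrite natr1 pnatr_eq0.
by rewrite -[k.+2%:R]natr1; move: q0 q1; move: (k.+1%:R) => q q0 q1; field; apply/andP.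
Qed.

Lemma le_mean (K : numFieldType) (u v : nat -> K) :
  (forall k, u k <= v k) -> forall k, mean u k <= mean v k.
Proof.
by move=> uv k; rewrite ler_wpM2l ?invr_ge0 ?ler0n // ler_sum.
Qed.

Lemma mean_affine (K : numFieldType) (a b : K) (u : nat -> K) k :
  mean (fun j => a + b * u j) k = a + b * mean u k.
Proof.
rewrite /mean big_split /= -mulr_sumr sumr_const card_ord mulrDr mulrCA.
by rewrite -[a *+ _]mulr_natl mulKf ?pnatr_eq0.
Qed.

Lemma mean_natr (K : numFieldType) k : mean (fun j => j%:R : K) k = k%:R / 2.
Proof.
elim: k => [|k IH]; first by rewrite /mean big_ord1 mulr0 mul0r.
have q0 : k%:R + 2 != 0 :> K by rewrite -natrD pnatr_eq0 addn2.
by rewrite meanS IH -[k.+2]addn2 natrD -[k.+1]addn1 natrD; field.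
Qed.

(** For a fixed point, [meanS] becomes [(1 - p) (u k.+1 - u k) = 0] with [p] different from 1. *)
Lemma fixed_mean_cst (K : numFieldType) (u : nat -> K) :
  mean u = u -> forall k, u k = u 0.
Proof.
move=> um; elim=> [//|k <-]; have := meanS u k; rewrite um => uS.
have p_neq0 : 1 - k.+2%:R^-1 != 0 :> K.
  by rewrite subr_eq0 eq_sym invr_eq1 (eqr_nat _ _ 1).
apply/eqP; rewrite -subr_eq0 -(mulrI_eq0 _ (mulfI p_neq0)); apply/eqP.
set p := k.+2%:R^-1 in uS *.
have -> : (1 - p) * (u k.+1 - u k) = u k.+1 - (p * u k.+1 + (1 - p) * u k).
  by ring.
by rewrite -uS subrr.
Qed.

(** * Uniform decay of the averages of an indicator *)

Section Window.
Variable R : realType.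

(** Index 0 is left out because averaging preserves the value there. *)
Definition window (m k : nat) : R := (0 < k <= m)%N%:R.

Let u m n k := iter n (@mean R) (window m) k.

Lemma iter_mean_window_ge0 m n k : 0 <= iter n (@mean R) (window m) k.
Proof.
elim: n k => [|n IH] k; first exact: ler0n.
by rewrite iterS mulr_ge0 ?invr_ge0 ?ler0n // sumr_ge0.
Qed.

Lemma iter_mean_window_le m n k :
  iter n (@mean R) (window m) k <= k%:R / 2 ^+ n.
Proof.
elim: n k => [|n IH] k.
  rewrite /= expr0 divr1 /window ler_nat; case: k => [|k]; first by rewrite ltnn.
  exact: leq_trans (leq_b1 _) _.
rewrite iterS; apply: le_trans (le_mean (v := fun j => 0 + (2 ^+ n)^-1 * j%:R) _ k) _.
  by move=> j; rewrite add0r mulrC.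
by rewrite mean_affine mean_natr add0r exprS invfM mulrC -mulrA.
Qed.

Lemma iter_mean_window_unif m (e : R) : 0 < e ->
  exists N, forall n k, (N <= n)%N -> iter n (@mean R) (window m) k <= e.
Proof.
move=> e0.
have [|||K HK] := @unif_small R (u m) m (m%:R ^+ 2) _ _ _ e e0.
- by move=> n k _; rewrite /u iterS meanS.
- by move=> k mk; rewrite /u /= /window [(k <= m)%N]leqNgt mk andbF.
(* Column [m] has squares at most [m^2 / 4^n]; bounding [4^-n] by [2^-n] makes the sum telescope. *)
- move=> N; apply: (@le_trans _ _ (m%:R ^+ 2 * (1 - (2 ^+ N)^-1))); last first.
    by rewrite ler_piMr ?sqr_ge0 // gerBl invr_ge0 exprn_ge0.
  elim: N => [|N IH]; first by rewrite big_ord0 expr0 invr1 subrr mulr0.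
  rewrite big_ord_recr /=.
  have h : (2 ^+ N.+1)^-1 = (2 ^+ N)^-1 / 2 :> R by rewrite exprS invfM mulrC.
  have : u m N.+1 m ^+ 2 <= m%:R ^+ 2 * (2 ^+ N.+1)^-1.
    apply: (@le_trans _ _ ((m%:R / 2 ^+ N.+1) ^+ 2)).
      rewrite ler_pXn2r ?nnegrE ?iter_mean_window_ge0 //.
        exact: iter_mean_window_le.
      by rewrite divr_ge0 ?exprn_ge0.
    rewrite exprMn ler_wpM2l ?sqr_ge0 // expr2 ler_piMl ?invr_ge0 ?exprn_ge0 //.
    by rewrite invf_le1 ?exprn_gt0 // exprn_ege1 // ler1n.
  move=> /(lerD IH) /le_trans; apply.
  by rewrite -mulrDr h ler_wpM2l ?sqr_ge0 //; lra.
have : (fun n => K%:R / 2 ^+ n : R) @ \oo --> (0 : R).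
  have half_lt1 : `|2^-1 : R| < 1.
    by rewrite ger0_norm ?invr_ge0 // invf_lt1 // ltr1n.
  have -> : (fun n => K%:R / 2 ^+ n) = geometric K%:R (2^-1 : R).
    by apply/funext => n; rewrite /= exprVn.
  exact: cvg_geometric.
move=> /cvgrPdist_le /(_ e e0) [N _ HN].
(* The successor excludes [n = 0], since [unif_small] only speaks of [u n.+1]. *)
exists N.+1 => -[//|n] k Nn.
have [kK|Kk] := leqP K k; first exact: HK.
apply: le_trans (iter_mean_window_le _ _ _) _.
have := HN n.+1 (leqW Nn); rewrite /= sub0r normrN; apply: le_trans.
apply: le_trans (ler_norm _); rewrite ler_wpM2r ?invr_ge0 ?exprn_ge0 //.
by rewrite ler_nat ltnW.
Qed.

End Window.

(** * Norm convergence of the orbit *)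

Section CesaroOperator.
Context {R : realType}.
Implicit Types x l : cspace R.

Lemma limitE (x : nat -> Cplx R) z : x @ \oo --> z -> limn x = z.
Proof. by apply: cvg_lim; exact: norm_hausdorff. Qed.

Lemma modulusN (z : Cplx R) : modulus (- z) = modulus z.
Proof. by have /(congr1 (@complex.Re R)) := normrN z. Qed.

Lemma modulus_cesaro_le_mean (x : nat -> Cplx R) (g : nat -> R) :
  (forall k, modulus (x k) <= g k) ->
  forall k, modulus (cesaro_seq x k) <= mean g k.
Proof.
move=> xg k; apply: le_trans (modulus_cesaro_le x k) _.
by rewrite /arithmetic_mean /= seriesEnat /= big_mkord; exact: (le_mean xg).
Qed.

(** Averaging is positive and fixes constants, so an affine majorant is carried along the orbit. *)
Lemma modulus_iter_cesaro_le x (a b : R) (f : nat -> R) :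
  (forall k, modulus (x k) <= a + b * f k) ->
  forall n k, modulus (iter n cesaro_op x k) <= a + b * iter n (@mean R) f k.
Proof.
move=> xf; elim=> [//|n IH] k; rewrite !iterS -mean_affine.
exact: modulus_cesaro_le_mean.
Qed.

Lemma supnorm_iter_cesaro_small x (e : R) : x 0 = 0 -> limn x = 0 -> 0 < e ->
  exists N, forall n, (N <= n)%N -> supnorm (iter n cesaro_op x) <= e.
Proof.
move=> x0 limx e0.
have M0 : 0 <= supnorm x := le_trans (modulus_ge0 _) (modulus_le_supnorm x 0).
have M1 : 0 < supnorm x + 1 by rewrite ltr_wpDl.
have e2 : 0 < e / 2 by rewrite divr_gt0.
have : modulus (0 - x n) @[n --> \oo] --> (0 : R).
  by apply/(cvgn_modulusP x); rewrite -limx; exact: cspace_cvg.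
move=> /cvgrPdist_le /(_ _ e2) [m _ Hm].
have xm k : (m <= k)%N -> modulus (x k) <= e / 2.
  move=> /Hm /=; rewrite sub0r normrN ger0_norm ?modulus_ge0 // sub0r.
  by rewrite modulusN.
(* The added 1 keeps the divisor positive when [x = 0]. *)
have d0 : 0 < e / 2 / (supnorm x + 1) by rewrite divr_gt0.
have [N HN] := iter_mean_window_unif m d0.
exists N => n Nn; apply: supnorm_le => k.
apply: le_trans (@modulus_iter_cesaro_le x (e / 2) (supnorm x) (window R m) _ n k) _.
  move=> j; rewrite /window; have [mj|jm] := leqP m j.
    apply: le_trans (xm _ mj) _.
    by rewrite lerDl mulr_ge0 ?ler0n.
  case: j jm => [|j] jm.
    by rewrite x0 [modulus 0]complex.ComplexField.Normc.normc0 mulr0 addr0 ltW.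
  rewrite (ltnW jm) mulr1; apply: le_trans (modulus_le_supnorm x _) _.
  by rewrite lerDr ltW.
apply: (@le_trans _ _ (e / 2 + (supnorm x + 1) * (e / 2 / (supnorm x + 1)))).
  rewrite lerD2l ler_pM ?iter_mean_window_ge0 ?HN //.
  by rewrite lerDl.
by rewrite [X in _ + X]mulrC divfK ?gt_eqF // -splitr.
Qed.

Lemma cesaro_op_P x : cesaro_op (P_op x) = P_op x.
Proof.
apply: val_inj; apply: funext => k.
suff : k.+1%:R^-1 * \sum_(j < k.+1) (x 0 * 1) = x 0 * 1 by [].
by rewrite sumr_const card_ord mulr1 -[x 0 *+ _]mulr_natl mulKf ?pnatr_eq0.
Qed.

(** Reduces the convergence to a sequence with zero initial term. *)
Lemma iter_cesaro_subP n x :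
  iter n cesaro_op x - P_op x = iter n cesaro_op (x - P_op x).
Proof.
elim: n => [//|n IH]; rewrite !iterS -IH linearB /=.
by rewrite cesaro_op_P.
Qed.

Lemma iter_cesaro_cvgP x : x 0 = limn x ->
  `|iter n cesaro_op x - P_op x| @[n --> \oo] --> (0 : Cplx R).
Proof.
move=> x0; apply/cvgrPdist_le => e /ofReal_posE[r r0 ->].
have y0 : (x - P_op x) 0 = 0.
  by have -> : (x - P_op x) 0 = x 0 - x 0 * 1 by []; rewrite mulr1 subrr.
have limy : limn (x - P_op x) = 0.
  apply: limitE.
  have -> : cseq (x - P_op x) = (fun k => x k - limn x).
    apply/funext => k; have -> : cseq (x - P_op x) k = x k - x 0 * 1 by [].
    by rewrite mulr1 x0.
  rewrite -[X in _ --> X](subrr (limn x)).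
  by apply: cvgB; [exact: cspace_cvg|exact: cvg_cst].
have [N HN] := supnorm_iter_cesaro_small y0 limy r0.
exists N => // n /= Nn; rewrite sub0r normrN normr_id iter_cesaro_subP.
by rewrite cspace_normE ofReal_le HN.
Qed.

(** * Continuous functionals and weak limits *)

Lemma bounded_functional_continuous (f : {linear cspace R -> (Cplx R)^o}) :
  (forall x, modulus (f x) <= supnorm x) -> continuous f.
Proof.
move=> fb; apply/linear_bounded_continuous/bounded_funP => r.
exists r => x; apply: le_trans.
by rewrite [X in X <= _]norm_modulus cspace_normE ofReal_le.
Qed.

Definition coordinate (k : nat) x : (Cplx R)^o := x k.

Fact coordinate_linear k : linear (coordinate k).
Proof. by []. Qed.

HB.instance Definition _ k := GRing.isLinear.Build (Cplx R) (cspace R)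
  (Cplx R)^o _ (coordinate k) (coordinate_linear k).

Lemma coordinate_continuous k : continuous (coordinate k).
Proof. by apply: bounded_functional_continuous => x; exact: modulus_le_supnorm. Qed.

Definition limit x : (Cplx R)^o := limn x.

Fact limit_linear : linear limit.
Proof.
move=> a x y; apply: limitE.
by apply: cvgD; [apply: cvgM; [exact: cvg_cst|]|]; exact: cspace_cvg.
Qed.

HB.instance Definition _ := GRing.isLinear.Build (Cplx R) (cspace R)
  (Cplx R)^o _ limit limit_linear.

Lemma limit_continuous : continuous limit.
Proof.
(* One term within [e] of the limit bounds it by the norm plus [e]. *)
apply: bounded_functional_continuous => x; apply/ler_addgt0Pl => e e0.
have /cvgn_modulusP /cvgrPdist_le /(_ _ e0) [N _ /(_ N (leqnn N)) /=] :=
  @cspace_cvg R x.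
rewrite sub0r normrN ger0_norm ?modulus_ge0 // => xN.
rewrite -[limit x](subrK (x N)); apply: le_trans (modulusD _ _) _.
by apply: lerD => //; exact: modulus_le_supnorm.
Qed.

Lemma coord0_iter_cesaro n x : iter n cesaro_op x 0 = x 0.
Proof.
elim: n => [//|n IH]; rewrite iterS -[RHS]IH.
by rewrite [LHS]/(cesaro_seq _ _) /cesaro_seq big_ord1 invr1 mul1r.
Qed.

Lemma limit_iter_cesaro n x : limit (iter n cesaro_op x) = limit x.
Proof.
elim: n => [//|n IH]; rewrite iterS -[RHS]IH.
by apply: limitE; apply: cesaro_seq_cvg; exact: cspace_cvg.
Qed.

(* [f \o T] is again a bounded functional, so a weak limit of the orbit is a
   fixed point of [T], that is a constant sequence. *)
Lemma weak_limit_cst x l :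
  weakly_cvg (fun n => iter n cesaro_op x) l -> forall k, l k = l 0.
Proof.
move=> wl k; apply: (@fixed_mean_cst (Cplx R) l); apply: funext => j.
have Tj_cont : continuous (coordinate j \o cesaro_op).
  apply: bounded_functional_continuous => y.
  apply: le_trans (modulus_le_supnorm (cesaro_op y) j) _.
  by rewrite -ofReal_le -!cspace_normE cesaro_op_contraction.
have lj := wl _ (@coordinate_continuous j); have Tlj := wl _ Tj_cont.
(* After this shift both limits concern the same scalar sequence, so [l j] is the average of [l] at
   [j]. *)
have {}lj : coordinate j (iter n.+1 cesaro_op x) @[n --> \oo] --> coordinate j l.
  exact: cvg_comp (cvg_addnl 1) lj.
exact: (cvg_unique (@norm_hausdorff _ (Cplx R)^o) Tlj lj).
Qed.

(** Both functionals are constant along the orbit, so they take the same values at [x] and [l]; on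
    the constant sequence [l] they agree. *)
Lemma weakly_cvg_coord0_limit x l :
  weakly_cvg (fun n => iter n cesaro_op x) l -> x 0 = limn x.
Proof.
move=> wl; have lcst := weak_limit_cst wl.
have := wl _ (@coordinate_continuous 0); have := wl _ limit_continuous.
have -> : (fun n => limit (iter n cesaro_op x)) = fun=> limit x.
  by apply: funext => n; exact: limit_iter_cesaro.
have -> : (fun n => coordinate 0 (iter n cesaro_op x)) = fun=> x 0.
  by apply: funext => n; exact: coord0_iter_cesaro.
move=> /(cvg_unique (@norm_hausdorff _ (Cplx R)^o) (cvg_cst _)) limx.
move=> /(cvg_unique (@norm_hausdorff _ (Cplx R)^o) (cvg_cst _)) x0.
rewrite x0 [RHS]limx; apply/esym/limitE.
have -> : cseq l = fun=> l 0 by apply: funext; exact: lcst.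
exact: cvg_cst.
Qed.

End CesaroOperator.

Theorem theorem2p2 (R : realType) (x : cspace R) :
  (x 0%N = limn x <->
     exists l : cspace R, weakly_cvg (fun n => iter n cesaro_op x) l) /\
  ((exists l : cspace R, weakly_cvg (fun n => iter n cesaro_op x) l) <->
     exists l : cspace R, iter n cesaro_op x @[n --> \oo] --> l) /\
  (x 0%N = limn x ->
     `|iter n cesaro_op x - P_op x| @[n --> \oo] --> (0 : Cplx R)).
Proof.
have i_iii : x 0%N = limn x ->
    exists l : cspace R, iter n cesaro_op x @[n --> \oo] --> l.
  by move=> /iter_cesaro_cvgP /norm_cvg0 /subr_cvg0 xP; exists (P_op x).
have iii_ii : (exists l : cspace R, iter n cesaro_op x @[n --> \oo] --> l) ->
    exists l : cspace R, weakly_cvg (fun n => iter n cesaro_op x) l.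
  by move=> [l xl]; exists l => f fc; apply: continuous_cvg xl; exact: fc.
have ii_i : (exists l : cspace R, weakly_cvg (fun n => iter n cesaro_op x) l) ->
    x 0%N = limn x.
  by move=> [l]; exact: weakly_cvg_coord0_limit.
split; [by split=> [/i_iii/iii_ii|]|split; [|exact: iter_cesaro_cvgP]].
by split=> [/ii_i/i_iii|].
Qed.
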